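(* Let $\mathcal{H},\mathcal{H}'$ be real Hilbert spaces, $(\varphi_\gamma)_{\gamma\in\Gamma}$ an orthonormal basis of $\mathcal{H}$, $K:\mathcal{H}\to\mathcal{H}'$ bounded linear with $\|K\|<1$, $g\in\mathcal{H}'$, $\Gamma=\Gamma_1\cup\dots\cup\Gamma_n$ pairwise disjoint, $p_i\in[1,2]$, $p_\gamma=p_i$ for $\gamma\in\Gamma_i$, weights $w_\gamma\ge c>0$. Let $\mathbf{S}_{W,P}(h)=\sum_\gamma S_{w_\gamma,p_\gamma}(\langle h,\varphi_\gamma\rangle)\varphi_\gamma$, $\mathbf{T}(f)=\mathbf{S}_{W,P}(f+K^*(g-Kf))$, $f^0\in\mathcal{H}$, $f^k=\mathbf{T}(f^{k-1})$, let $f^*$ be the weak limit of $(f^k)$, and put $u^k=f^k-f^*$, $h=f^*+K^*(g-Kf^* )$. Then: (A) $\|Ku^k\|\to0$; (B) $\|\mathbf{S}_{W,P}(h+u^k)-\mathbf{S}_{W,P}(h)-u^k\|\to0$; (C) if $a\in\mathcal{H}$ and $(v^k)$ is a sequence in $\mathcal{H}$ with $v^k\to0$ weakly and $\|\mathbf{S}_{W,P}(a+v^k)-\mathbf{S}_{W,P}(a)-v^k\|\to0$, then $\|v^k\|\to0$; (D) $\|u^k\|\to0$, i.e. $f^k\to f^*$ in norm.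
   Context: For $c>0$, $p\ge1$: $S_{c,p}(t)=F_{c,p}^{-1}(t)$ if $p>1$, with $F_{c,p}(t)=t+\frac{cp}2\operatorname{sign}(t)|t|^{p-1}$; $S_{c,1}(t)=t-\frac c2$ if $t>\frac c2$, $0$ if $|t|\le\frac c2$, $t+\frac c2$ if $t<-\frac c2$. It is known under these hypotheses that $(f^k)$ converges weakly to some $f^*\in\mathcal{H}$. All limits are as $k\to\infty$. *)

(* Defs.v *)
From HB Require Import structures.
From mathcomp Require Import all_boot all_order all_algebra finmap.
From mathcomp Require Import all_classical all_reals all_analysis.
Set Implicit Arguments. Unset Strict Implicit. Unset Printing Implicit Defensive.
Import Order.TTheory GRing.Theory Num.Theory Num.Def.
Import numFieldNormedType.Exports.
Local Open Scope classical_set_scope.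
Local Open Scope ring_scope.

Definition totally {I : choiceType} : set_system {fset I} :=
  filter_from setT (fun A => [set B | (A `<=` B)%fset]).

Instance totally_filter {I : choiceType} : ProperFilter (@totally I).
Proof.
eapply filter_from_proper; last by move=> A _; exists A; rewrite /= fsubset_refl.
apply: filter_fromT_filter; first by exists fset0.
by move=> A B /=; exists (A `|` B)%fset => P /=; rewrite fsubUset => /andP[].
Qed.

Definition partial_sum {I : choiceType} {V : zmodType}
  (x : I -> V) (A : {fset I}) : V := \sum_(i : A) x (val i).

Definition hsum {R : realType} {I : choiceType} {V : normedModType R}
  (x : I -> V) : V := lim (partial_sum x @ totally).

Definition inner_product {R : realType} {V : normedModType R}
  (ip : V -> V -> R) : Prop :=
  [/\ forall x y, ip x y = ip y x,
      forall a x y z, ip (a *: x + y) z = a * ip x z + ip y z &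
      forall x, ip x x = `|x| ^+ 2].

Definition orthonormal_basis {R : realType} {V : normedModType R}
  (ip : V -> V -> R) {I : choiceType} (phi : I -> V) : Prop :=
  (forall a b, ip (phi a) (phi b) = if a == b then 1 else 0) /\
  (forall h, (forall a, ip h (phi a) = 0) -> h = 0).

Definition Fcp {R : realType} (c p t : R) : R :=
  t + c * p / 2 * (sgr t * (`|t| `^ (p - 1))).

Definition Scp {R : realType} (c p t : R) : R :=
  if 1 < p then get [set s | Fcp c p s = t]
  else if c / 2 < t then t - c / 2
  else if t < - (c / 2) then t + c / 2
  else 0.

Definition SWP {R : realType} {V : normedModType R} (ip : V -> V -> R)
  {I : choiceType} (phi : I -> V) (w p : I -> R) (h : V) : V :=
  hsum (fun g => Scp (w g) (p g) (ip h (phi g)) *: phi g).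

Definition weak_cvg {R : realType} {V : normedModType R} (ip : V -> V -> R)
  (u : nat -> V) (l : V) : Prop :=
  forall y, (fun k => ip (u k) y) @ \oo --> ip l y.

(* Main.v *)
(** The iteration map is [x |-> S (x + K^*(g - K x))] with [S] acting
coordinatewise by scalar shrinkages. Each shrinkage [s] is monotone and
nonexpansive, so [2 s - 1] is nonexpansive, hence so is [2 S - 1] and [S] is
firmly nonexpansive. Continuity of the coordinates makes the weak limit [f^*] a
fixed point. Firm nonexpansiveness applied to [h + t^k] and [h], where
[t^k = u^k - K^* K u^k], gives
[|u^(k+1)|^2 + |K u^k|^2 + |t^k - u^(k+1)|^2 <= |u^k|^2],
so the last two terms of the left-hand side tend to [0]; this yields (A) and (B).

For (C), let [d] be the defect [S (a + v) - S a - v]. All but finitely many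
coordinates of [a] are at most [c/4], and [|d| < c/4] eventually; in such a
coordinate [|v_i| <= C |d_i|] with [C] depending only on [c] and the finitely
many exponents, and the remaining finitely many coordinates of [v^k] tend to
[0] by weak convergence. *)

Require Import Defs.
From HB Require Import structures.
From mathcomp Require Import all_boot all_order all_algebra finmap.
From mathcomp Require Import all_classical all_reals all_analysis.
From mathcomp Require Import ring lra.
Import Order.TTheory GRing.Theory Num.Theory Num.Def.
Import numFieldNormedType.Exports.
Local Open Scope classical_set_scope.
Local Open Scope ring_scope.

(** * Signed powers and scalar shrinkage functions *)

Section shrinkage.
Variable R : realType.
Implicit Types a b c p q r s t v w x y : R.

Lemma powR_le_affine q x : 0 < q <= 1 -> 0 <= x -> x `^ q <= 1 + q * (x - 1).
Proof.
move=> /andP[q0 q1]; rewrite le_eqVlt => /predU1P[<-|x0].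
  by rewrite powR0 ?gt_eqF//; lra.
rewrite -{2}(lnK x0) /powR gt_eqF//; set L := ln x.
have e1 := expR_ge1Dx ((1 - q) * L); have e2 := expR_ge1Dx (- (q * L)).
have -> : expR L = expR (q * L) * expR ((1 - q) * L).
  by rewrite -expRD; congr expR; ring.
have h0 := expR_gt0 (q * L).
have h1 : expR (q * L) * expR (- (q * L)) = 1.
  by rewrite -expRD subrr expR0.
(* [expR y >= 1 + y] at [(1 - q) L] and [- q L], weighted by [q] and [1 - q]. *)
have : 1 <= q * expR ((1 - q) * L) + (1 - q) * expR (- (q * L)) by nra.
rewrite -(ler_pM2l h0) => h2.
suff: expR (q * L) * 1 <= q * (expR (q * L) * expR ((1 - q) * L)) +
   (1 - q) * (expR (q * L) * expR (- (q * L))) by rewrite h1; lra.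
by apply: le_trans h2 _; lra.
Qed.

(** Factor out x^q and use the affine bound at [y / x]; then x <= x^q on [0, 1] gives the slope
    [q]. *)
Lemma powR_diff_ge q x y : 0 < q <= 1 -> 0 <= y -> y <= x -> x <= 1 ->
  q * (x - y) <= x `^ q - y `^ q.
Proof.
move=> q01 y0 yx x1; have /andP[q0 q1] := q01.
have [x0|x0] := leP x 0.
  have -> : x = 0 by lra.
  have -> : y = 0 by lra.
  by rewrite !subrr mulr0.
have xq : x <= x `^ q.
  by rewrite -{1}(powRr1 (ltW x0)); apply: ger_powR => //; rewrite x0 x1.
have yE : y `^ q = x `^ q * (y / x) `^ q.
  by rewrite -powRM ?divr_ge0// ?(ltW x0)// mulrCA divff ?mulr1 ?gt_eqF.
have := powR_le_affine q (y / x) q01 (divr_ge0 y0 (ltW x0)).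
rewrite -(ler_pM2l (lt_le_trans x0 xq)) -yE => h.
have z1 : y / x <= 1 by rewrite ler_pdivrMr ?mul1r.
have E : x - y = x * (1 - y / x) by field; rewrite gt_eqF.
have : q * (x * (1 - y / x)) <= q * (x `^ q * (1 - y / x)).
  by rewrite ler_pM2l// ler_wpM2r// subr_ge0.
by rewrite E; lra.
Qed.

(** The odd extension of the power function; at exponent [p - 1] it is the nonlinear term of
    [Fcp]. *)
Definition spowR q x := sgr x * `|x| `^ q.

Lemma spowRN q x : spowR q (- x) = - spowR q x.
Proof. by rewrite /spowR sgrN normrN mulNr. Qed.

Lemma spowR_ge0E q x : 0 < q -> 0 <= x -> spowR q x = x `^ q.
Proof.
move=> q0; rewrite le_eqVlt => /predU1P[<-|x0].
  by rewrite /spowR sgr0 mul0r powR0 ?gt_eqF.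
by rewrite /spowR gtr0_sg// gtr0_norm// mul1r.
Qed.

Lemma spowR_le0E q x : 0 < q -> x <= 0 -> spowR q x = - (- x) `^ q.
Proof. by move=> q0 x0; rewrite -[in LHS](opprK x) spowRN spowR_ge0E ?oppr_ge0. Qed.

Lemma le_spowR q x y : 0 < q -> x <= y -> spowR q x <= spowR q y.
Proof.
move=> q0 xy.
have mono a b : 0 <= a -> a <= b -> a `^ q <= b `^ q.
  move=> a0 ab; have b0 := le_trans a0 ab.
  by apply: ge0_ler_powR; rewrite ?nnegrE// ltW.
have [x0|x0] := leP 0 x.
  by rewrite !spowR_ge0E//; [exact: mono|lra].
have [y0|y0] := leP 0 y.
  rewrite (spowR_ge0E _ y)// (spowR_le0E _ _ q0 (ltW x0)).
  by have := powR_ge0 (- x) q; have := powR_ge0 y q; lra.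
rewrite (spowR_le0E _ _ q0 (ltW x0)) (spowR_le0E _ _ q0 (ltW y0)).
by rewrite lerN2; apply: mono; lra.
Qed.

Lemma spowR_diff_ge q x y : 0 < q <= 1 -> `|x| <= 1 -> `|y| <= 1 -> y <= x ->
  q * (x - y) <= spowR q x - spowR q y.
Proof.
move=> q01; rewrite !ler_norml => /andP[xm xM] /andP[ym yM] yx.
have /andP[q0 q1] := q01.
have [y0|y0] := leP 0 y.
  by rewrite !spowR_ge0E//; [exact: powR_diff_ge|lra].
have [x0|x0] := leP 0 x.
  (* Opposite signs: split the increment at 0 and bound the two pieces separately. *)
  rewrite (spowR_ge0E _ x)// (spowR_le0E _ _ q0 (ltW y0)).
  have := powR_diff_ge q x 0 q01 (lexx _) x0 xM.
  have := powR_diff_ge q (- y) 0 q01 (lexx _).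
  rewrite !powR0 ?gt_eqF// => h1 h2.
  have := h1 ltac:(lra) ltac:(lra).
  lra.
rewrite (spowR_le0E _ _ q0 (ltW x0)) (spowR_le0E _ _ q0 (ltW y0)).
by have := powR_diff_ge q (- y) (- x) q01; lra.
Qed.

Lemma norm_spowR_diff_ge q x y : 0 < q <= 1 -> `|x| <= 1 -> `|y| <= 1 ->
  q * `|x - y| <= `|spowR q x - spowR q y|.
Proof.
move=> q01 x1 y1; wlog yx : x y x1 y1 / y <= x.
  move=> h; have [/h|/ltW /h] := leP y x; first exact.
  by rewrite distrC (distrC (spowR _ _)); apply.
rewrite ger0_norm ?subr_ge0// (le_trans _ (ler_norm _))//.
exact: spowR_diff_ge.
Qed.

Lemma norm_spowR_le1 q x : 0 < q -> `|spowR q x| <= 1 -> `|x| <= 1.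
Proof.
move=> q0; apply: contraTT; rewrite -!ltNge => x1.
have x0 : x != 0 by apply: contraTneq x1 => ->; rewrite normr0 ltr10.
rewrite /spowR normrM normr_sg x0 mul1r (ger0_norm (powR_ge0 _ _)).
have := @gt0_ltr_powR R q q0 1 `|x|.
by rewrite powR1; apply=> //; rewrite nnegrE ?ler01.
Qed.

Lemma FcpN w p x : Fcp w p (- x) = - Fcp w p x.
Proof. by rewrite /Fcp sgrN normrN; ring. Qed.

Lemma FcpE w p x : Fcp w p x = x + w * p / 2 * spowR (p - 1) x.
Proof. by []. Qed.

Lemma Fcp_surj w p t : 0 < w -> 1 < p -> exists x, Fcp w p x = t.
Proof.
move=> w0 p1.
have pos a : 0 < a -> exists x, Fcp w p x = a.
  move=> a0; have q0 : 0 < p - 1 by rewrite subr_gt0.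
  have wp : 0 < w * p by rewrite mulr_gt0// (lt_trans ltr01).
  (* [powR] is only known to be differentiable away from [0], so the
     intermediate value theorem is applied on [[e, a]] with [Fcp w p e <= a]. *)
  pose z := (a / (w * p)) `^ (p - 1)^-1.
  have z0 : 0 < z by rewrite powR_gt0// divr_gt0.
  (* [z] solves w p z^(p-1) = a, so [e <= z] and [e <= a / 2] make each summand of [Fcp w p e] at
     most [a / 2]. *)
  pose e := minr z (a / 2).
  have e0 : 0 < e by rewrite /e lt_min z0/=; lra.
  have ea : e <= a / 2 by rewrite /e ge_min lexx orbT.
  have ez : e `^ (p - 1) <= a / (w * p).
    have -> : a / (w * p) = z `^ (p - 1).
      by rewrite /z -powRrM mulVf ?gt_eqF// powRr1// ltW// divr_gt0.
    apply: ge0_ler_powR; rewrite ?nnegrE ?(ltW e0) ?(ltW z0) ?(ltW q0)//.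
    by rewrite /e ge_min lexx.
  have ct : {within `[e, a], continuous (fun s => s + w * p / 2 * s `^ (p - 1))}.
    apply: continuous_in_subspaceT => s; rewrite inE/= in_itv/= => /andP[es _].
    apply: cvgD; first exact: cvg_id.
    apply: cvgM; first exact: cvg_cst.
    have s0 : s \in `]0, +oo[ by rewrite in_itv/= andbT (lt_le_trans e0).
    have : {for s, continuous (fun y : R => y `^ (p - 1))}.
      apply: differentiable_continuous.
      by apply/derivable1_diffP; exact: derivable_powR.
    exact.
  have FE s : 0 <= s -> Fcp w p s = s + w * p / 2 * s `^ (p - 1).
    by move=> s0; rewrite FcpE spowR_ge0E.
  have he : e + w * p / 2 * e `^ (p - 1) <= a.
    have : w * p / 2 * e `^ (p - 1) <= w * p / 2 * (a / (w * p)).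
      by rewrite ler_pM2l// divr_gt0.
    have -> : w * p / 2 * (a / (w * p)) = a / 2.
      by field; rewrite !gt_eqF// (lt_trans ltr01).
    lra.
  have ha : a <= a + w * p / 2 * a `^ (p - 1).
    by rewrite lerDl mulr_ge0 ?powR_ge0// divr_ge0// ltW.
  have [] := IVT _ ct (v := a).
  - lra.
  - by rewrite ge_min he/= le_max ha orbT.
  move=> s; rewrite in_itv/= => /andP[es _] <-; exists s.
  by rewrite FE// (le_trans (ltW e0)).
case: (ltrgtP t 0) => [t0|/pos//|->].
  have [|x xE] := pos (- t); first by rewrite oppr_gt0.
  by exists (- x); rewrite FcpN xE opprK.
by exists 0; rewrite FcpE /spowR sgr0 mul0r mulr0 addr0.
Qed.

(** Surjectivity makes the solution set nonempty, so [get] does not fall back on its default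
    value. *)
Lemma Fcp_Scp w p t : 0 < w -> 1 < p -> Fcp w p (Scp w p t) = t.
Proof.
move=> w0 p1; rewrite /Scp p1.
have [x xt] := Fcp_surj w p t w0 p1.
exact: (@getI _ [set s | Fcp w p s = t] x xt).
Qed.

(** Adding a nondecreasing term to the identity cannot shrink increments; hence the inverse [Scp]
    cannot enlarge them. *)
Lemma Fcp_expansive w p x y : 0 < w -> 1 < p -> x <= y ->
  y - x <= Fcp w p y - Fcp w p x.
Proof.
move=> w0 p1 xy; rewrite !FcpE.
have := le_spowR (p - 1) x y; rewrite subr_gt0 => /(_ p1 xy) h.
have : w * p / 2 * spowR (p - 1) x <= w * p / 2 * spowR (p - 1) y.
  by rewrite ler_wpM2l// !mulr_ge0 ?invr_ge0// ltW// (lt_trans ltr01).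
lra.
Qed.

Lemma Scp1E w p t : ~~ (1 < p) -> Scp w p t =
  if w / 2 < t then t - w / 2 else if t < - (w / 2) then t + w / 2 else 0.
Proof. by move=> /negbTE np; rewrite /Scp np. Qed.

Lemma Scp_mono w p s t : 0 < w -> 1 <= p -> s <= t ->
  0 <= Scp w p t - Scp w p s <= t - s.
Proof.
move=> w0 p1 st; have [p1'|np] := boolP (1 < p); last first.
  rewrite !Scp1E//.
  case: (ltP (w / 2) s) => ?; case: (ltP s (- (w / 2))) => ?;
  case: (ltP (w / 2) t) => ?; case: (ltP t (- (w / 2))) => ?; lra.
set x := Scp w p s; set y := Scp w p t.
have xs : Fcp w p x = s by apply: Fcp_Scp.
have yt : Fcp w p y = t by apply: Fcp_Scp.
have [xy|/ltW yx] := leP x y.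
  have := Fcp_expansive w p x y w0 p1' xy; lra.
(* The reversed order forces [x = y], because [s <= t]. *)
have := Fcp_expansive w p y x w0 p1' yx; lra.
Qed.

Lemma Scp0 w p : 0 < w -> 1 <= p -> Scp w p 0 = 0.
Proof.
move=> w0 p1; have [p1'|np] := boolP (1 < p); last first.
  rewrite !Scp1E//.
  by case: (ltP (w / 2) 0) => ?; case: (ltP 0 (- (w / 2))) => ?; lra.
have F0 : Fcp w p 0 = 0 by rewrite FcpE /spowR sgr0 mul0r mulr0 addr0.
have xs : Fcp w p (Scp w p 0) = 0 by apply: Fcp_Scp.
have := Fcp_expansive w p 0 (Scp w p 0) w0 p1'.
have := Fcp_expansive w p (Scp w p 0) 0 w0 p1'.
rewrite xs F0; case: (ltrgtP (Scp w p 0) 0) => [x0|x0|//].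
  by move=> /(_ isT); lra.
by move=> _ /(_ isT); lra.
Qed.

Lemma Scp_nonexpansive w p s t : 0 < w -> 1 <= p ->
  `|Scp w p t - Scp w p s| <= `|t - s|.
Proof.
move=> w0 p1; wlog st : s t / s <= t.
  move=> h; have [/h|/ltW /h] := leP s t; first exact.
  by rewrite distrC (distrC t).
by have /andP[h1 h2] := Scp_mono w p s t w0 p1 st; rewrite !ger0_norm//; lra.
Qed.

Lemma norm_Scp_le w p t : 0 < w -> 1 <= p -> `|Scp w p t| <= `|t|.
Proof.
by move=> w0 p1; have := Scp_nonexpansive w p 0 t w0 p1; rewrite Scp0// !subr0.
Qed.

(** For [s <= t] the increment d of [Scp] lies in [0, t - s], so 2d - (t - s) lies in
    [-(t - s), t - s]. *)
Lemma Scp_reflection_nonexpansive w p s t : 0 < w -> 1 <= p ->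
  `|2 * (Scp w p t - Scp w p s) - (t - s)| <= `|t - s|.
Proof.
move=> w0 p1; wlog st : s t / s <= t.
  move=> h; have [/h|/ltW /h] := leP s t; first exact.
  have -> : 2 * (Scp w p t - Scp w p s) - (t - s) =
      - (2 * (Scp w p s - Scp w p t) - (s - t)) by ring.
  by rewrite normrN (distrC t).
have /andP[h1 h2] := Scp_mono w p s t w0 p1 st.
by rewrite (ger0_norm (x := t - s)) ?subr_ge0// ler_norml; lra.
Qed.

Lemma norm_sub_Scp_le w p t : 0 < w -> 1 <= p -> `|t - Scp w p t| <= `|t|.
Proof.
move=> w0 p1; have [t0|/ltW t0] := leP 0 t.
  have := Scp_mono w p 0 t w0 p1 t0; rewrite Scp0// => /andP[h1 h2].
  by rewrite !ger0_norm; lra.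
have := Scp_mono w p t 0 w0 p1 t0; rewrite Scp0// => /andP[h1 h2].
by rewrite !ler0_norm; lra.
Qed.

(* [C] does not depend on [w], which is bounded below only. For [p > 1], with
   [G x = w p / 2 * spowR (p - 1) x], the defect is [- (G r - G s)] for
   [r = Scp w p (a + v)] and [s = Scp w p a]; the smallness assumptions force
   [|r|, |s| <= 1], where [G] has slope at least [w p (p - 1) / 2]. *)
Lemma Scp_perturbation c p : 0 < c -> 1 <= p <= 2 ->
  exists2 C, 0 <= C & forall w a v, c <= w -> `|a| <= c / 4 ->
    `|Scp w p (a + v) - Scp w p a - v| < c / 4 ->
    `|v| <= C * `|Scp w p (a + v) - Scp w p a - v|.
Proof.
move=> c0 /andP[p1 p2]; have [p1'|np] := boolP (1 < p); last first.
  exists 1 => // w a v cw; rewrite mul1r ler_norml => /andP[a1 a2].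
  (* Here |a| <= c/4 < w/2, so [a] is shrunk to 0. If [a + v] leaves the dead zone, the defect is
     [a - w / 2] or [a + w / 2], of size at least c/4, a contradiction; otherwise it is [- v]. *)
  rewrite !Scp1E//; case: (ltP (w / 2) a) => ?; first lra.
  case: (ltP a (- (w / 2))) => ?; first lra.
  case: (ltP (w / 2) (a + v)) => ?; last case: (ltP (a + v) (- (w / 2))) => ?.
  - by rewrite ltr_norml; lra.
  - by rewrite ltr_norml; lra.
  - by rewrite subrr sub0r normrN.
have q01 : 0 < p - 1 <= 1 by apply/andP; split; lra.
have /andP[q0 q1] := q01.
(* The second term is the reciprocal of a lower bound for the slope of G; the 1 comes from |v| <= |r
   - s| + |r - s - v|. *)
exists (1 + 2 / ((p - 1) * c)).
  by rewrite addr_ge0// divr_ge0// ltW// mulr_gt0.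
move=> w a v cw ac; have w0 : 0 < w by exact: lt_le_trans cw.
have rE : Fcp w p (Scp w p (a + v)) = a + v by apply: Fcp_Scp.
have sE : Fcp w p (Scp w p a) = a by apply: Fcp_Scp.
have sa := norm_sub_Scp_le w p a w0 p1.
move: rE sE sa; set r := Scp w p (a + v); set s := Scp w p a.
rewrite !FcpE; set m := w * p / 2 => rE sE sa dc.
have cm : c / 2 <= m by rewrite /m ler_pM2r// -[c]mulr1 ler_pM// ltW.
have m0 : 0 < m by apply: lt_le_trans cm; rewrite divr_gt0.
have Gs : m * `|spowR (p - 1) s| <= c / 4.
  by rewrite -{1}(gtr0_norm m0) -normrM (_ : m * _ = a - s); lra.
have dE : r - s - v = - (m * (spowR (p - 1) r - spowR (p - 1) s)) by lra.
have dN : `|r - s - v| = m * `|spowR (p - 1) r - spowR (p - 1) s|.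
  by rewrite dE normrN normrM gtr0_norm.
(* The bound c/4 at [s] plus a defect below c/4 gives c/2, which is at most [m]; dividing by [m]
   bounds the power by 1. *)
have Gr : m * `|spowR (p - 1) r| <= c / 2.
  have : `|spowR (p - 1) r| <=
      `|spowR (p - 1) r - spowR (p - 1) s| + `|spowR (p - 1) s|.
    by rewrite -{1}(subrK (spowR (p - 1) s) (spowR (p - 1) r)) ler_normD.
  by rewrite -(ler_pM2l m0) mulrDr -dN; lra.
have small x : m * `|spowR (p - 1) x| <= c / 2 -> `|x| <= 1.
  move=> hx; apply: (norm_spowR_le1 _ _ q0).
  by rewrite -(ler_pM2l m0) mulr1 (le_trans hx).
have r1 := small _ Gr; have s1 : `|s| <= 1 by apply: small; lra.
have := norm_spowR_diff_ge _ r s q01 r1 s1.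
set D := `|_ - spowR _ _| in dN *; move=> hD.
have rs : `|r - s| <= 2 / ((p - 1) * c) * `|r - s - v|.
  have -> : 2 / ((p - 1) * c) * `|r - s - v| = `|r - s - v| / (c / 2) / (p - 1).
    by field; rewrite !gt_eqF.
  rewrite ler_pdivlMr// mulrC (le_trans hD)// ler_pdivlMr ?divr_gt0//.
  by rewrite dN mulrC ler_wpM2r ?normr_ge0.
have : `|v| <= `|r - s| + `|r - s - v|.
  by rewrite -{1}(subKr (r - s) v) ler_normB.
by rewrite mulrDl mul1r; lra.
Qed.

End shrinkage.

Set Implicit Arguments.
Unset Strict Implicit.

(** * Inner product identities and Cauchy-Schwarz *)

Section inner_product_theory.
Variables (R : realType) (V : normedModType R) (ip : V -> V -> R).
Hypothesis hip : inner_product ip.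
Implicit Types x y z : V.

Lemma ipC x y : ip x y = ip y x. Proof. by case: hip. Qed.

Lemma ip_norm x : ip x x = `|x| ^+ 2. Proof. by case: hip. Qed.

Lemma ipDl x y z : ip (x + y) z = ip x z + ip y z.
Proof. by case: hip => _ h _; rewrite -[x in LHS]scale1r h mul1r. Qed.

Lemma ip0l z : ip 0 z = 0.
Proof. by apply: (addrI (ip 0 z)); rewrite -ipDl !addr0. Qed.

Lemma ipZl a x z : ip (a *: x) z = a * ip x z.
Proof. by case: hip => _ h _; rewrite -[a *: x]addr0 h ip0l addr0. Qed.

Lemma ipNl x z : ip (- x) z = - ip x z.
Proof. by rewrite -scaleN1r ipZl mulN1r. Qed.

Lemma ipBl x y z : ip (x - y) z = ip x z - ip y z.
Proof. by rewrite ipDl ipNl. Qed.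

Lemma ipZr a x z : ip z (a *: x) = a * ip z x.
Proof. by rewrite !(ipC z) ipZl. Qed.

Lemma ipBr x y z : ip z (x - y) = ip z x - ip z y.
Proof. by rewrite !(ipC z) ipBl. Qed.

Lemma ip_suml (I : Type) (s : seq I) (F : I -> V) z :
  ip (\sum_(i <- s) F i) z = \sum_(i <- s) ip (F i) z.
Proof.
elim: s => [|i s IH]; first by rewrite !big_nil ip0l.
by rewrite !big_cons ipDl IH.
Qed.

Lemma norm_sqrB x y : `|x - y| ^+ 2 = `|x| ^+ 2 - 2 * ip x y + `|y| ^+ 2.
Proof. by rewrite -!ip_norm ipBl !ipBr (ipC y x); ring. Qed.

(** Expand the squared distance from [x] to its projection on the line of [y]. *)
Lemma Cauchy_Schwarz x y : `|ip x y| <= `|x| * `|y|.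
Proof.
have [->|y0] := eqVneq y 0; first by rewrite ipC ip0l normr0 mulr_ge0.
rewrite -(ler_pXn2r (ltn0Sn 1)) ?nnegrE ?mulr_ge0// exprMn real_normK ?num_real//.
have n0 : 0 < `|y| ^+ 2 by rewrite exprn_gt0// normr_gt0.
have := sqr_ge0 `|x - (ip x y / `|y| ^+ 2) *: y|.
rewrite norm_sqrB ipZr normrZ exprMn real_normK ?num_real//.
have -> : `|x| ^+ 2 - 2 * (ip x y / `|y| ^+ 2 * ip x y) +
    (ip x y / `|y| ^+ 2) ^+ 2 * `|y| ^+ 2 = `|x| ^+ 2 - ip x y ^+ 2 / `|y| ^+ 2.
  by field; rewrite normr_eq0.
by rewrite subr_ge0 ler_pdivrMr.
Qed.

Lemma cvg_ipl T (F : set_system T) {FF : Filter F} (f : T -> V) x z :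
  f @ F --> x -> (fun t => ip (f t) z) @ F --> ip x z.
Proof.
move=> fx; apply/cvgrPdist_lt => e e0.
have e'0 : 0 < e / (`|z| + 1) by rewrite divr_gt0// ltr_pwDr.
near=> t; have : `|x - f t| < e / (`|z| + 1).
  by near: t; exact: cvgr_dist_lt.
rewrite ltr_pdivlMr ?ltr_pwDr// => h.
rewrite -ipBl (le_lt_trans (Cauchy_Schwarz _ _))// (le_lt_trans _ h)//.
by rewrite ler_wpM2l// lerDl.
Unshelve. all: by end_near. Qed.

End inner_product_theory.

(** * Orthonormal expansions, Bessel and Parseval *)

Section orthonormal_expansion.
Variables (R : realType) (V : completeNormedModType R) (ip : V -> V -> R).
Hypothesis hip : inner_product ip.
Variables (I : choiceType) (phi : I -> V).
Hypothesis hphi : orthonormal_basis ip phi.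
Implicit Types (A B : {fset I}) (c : I -> R) (x y : V).

Lemma partial_sumE (x : I -> V) A : partial_sum x A = \sum_(i <- A) x i.
Proof. by rewrite big_seq_fsetE. Qed.

Lemma sum_fset_subset (W : zmodType) A B (F : I -> W) : (A `<=` B)%fset ->
  \sum_(i <- B) F i = \sum_(i <- A) F i + \sum_(i <- (B `\` A)%fset) F i.
Proof.
move=> AB; rewrite (big_fsetID _ (mem A)) /=; congr (_ + _); apply: eq_fbigl => i.
  by rewrite !inE andbC; case: (boolP (i \in A)) => //= /(fsubsetP AB) ->.
by rewrite !inE andbC.
Qed.

Lemma ip_sum_phi c A a :
  ip (\sum_(i <- A) c i *: phi i) (phi a) = if a \in A then c a else 0.
Proof.
have [orth _] := hphi; rewrite (ip_suml hip).
under eq_bigr => i _ do rewrite (ipZl hip) orth.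
case: ifPn => aA.
  rewrite (big_fsetD1 a)//= eqxx mulr1 big_seq big1 ?addr0// => i.
  by rewrite !inE => /andP[/negbTE -> _]; rewrite mulr0.
rewrite big_seq big1// => i iA; case: eqP => [ia|]; last by rewrite mulr0.
by rewrite -ia iA in aA.
Qed.

Lemma norm_sum_phi c A : `|\sum_(i <- A) c i *: phi i| ^+ 2 = \sum_(i <- A) c i ^+ 2.
Proof.
rewrite -(ip_norm hip) {1}(ip_suml hip) [LHS]big_seq [RHS]big_seq.
apply: eq_bigr => i iA; rewrite (ipZl hip) (ipC hip) ip_sum_phi iA.
by rewrite expr2.
Qed.

Lemma norm_phi i : `|phi i| = 1.
Proof.
have [orth _] := hphi.
by apply/eqP; rewrite -sqrp_eq1// -(ip_norm hip) orth eqxx.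
Qed.

Lemma Bessel x A : \sum_(i <- A) ip x (phi i) ^+ 2 <= `|x| ^+ 2.
Proof.
set s := \sum_(i <- A) ip x (phi i) *: phi i.
have xs : ip x s = \sum_(i <- A) ip x (phi i) ^+ 2.
  rewrite (ipC hip) (ip_suml hip); apply: eq_bigr => i _.
  by rewrite (ipZl hip) (ipC hip) expr2.
have := sqr_ge0 `|x - s|.
by rewrite (norm_sqrB hip) norm_sum_phi xs; lra.
Qed.

(** Choose [A] whose sum is within [e] of the supremum of all finite sums; a disjoint [B] can add no
    more than [e]. *)
Lemma fset_tail_small c M e : 0 < e -> (forall A, \sum_(i <- A) c i ^+ 2 <= M) ->
  exists A, forall B, [disjoint A & B]%fset -> \sum_(i <- B) c i ^+ 2 <= e.
Proof.
move=> e0 cM; pose E := [set \sum_(i <- A) c i ^+ 2 | A in [set: {fset I}]].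
have hE : has_sup E.
  split; first by exists (\sum_(i <- fset0) c i ^+ 2), fset0.
  by exists M => _ [A _ <-]; exact: cM.
have [_ [A _ <-] hA] := sup_adherent e0 hE; exists A => B AB.
have : \sum_(i <- (A `|` B)%fset) c i ^+ 2 <= sup E.
  by apply: sup_upper_bound => //; exists (A `|` B)%fset.
rewrite (@sum_fset_subset _ A)//; last exact: fsubsetUl.
have -> : ((A `|` B) `\` A = B)%fset.
  apply/fsetP => i; rewrite !inE; have [iA|//] := boolP (i \in A).
  by rewrite (negbTE (fdisjointP AB _ iA)).
lra.
Qed.

(** By orthonormality the squared norm of a difference of partial sums is a tail of squares, so the
    net is Cauchy. *)
Lemma cvg_sum_phi c M : (forall A, \sum_(i <- A) c i ^+ 2 <= M) ->
  cvg (partial_sum (fun i => c i *: phi i) @ totally).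
Proof.
move=> cM; apply: cauchy_cvg; apply: cauchy_exP => e e0.
have e'0 : 0 < (e / 2) ^+ 2 by rewrite exprn_gt0// divr_gt0.
have [A hA] := fset_tail_small e'0 cM.
exists (\sum_(i <- A) c i *: phi i), A => // B /= AB.
rewrite -ball_normE /ball_/= partial_sumE (sum_fset_subset _ AB).
rewrite opprD addNKr normrN (@le_lt_trans _ _ (e / 2))//; last lra.
rewrite -(ler_pXn2r (ltn0Sn 1)) ?nnegrE ?divr_ge0 ?(ltW e0)//.
rewrite norm_sum_phi hA//; apply/fdisjointP => i iA.
by rewrite !inE iA.
Qed.

Lemma ip_hsum_phi c M a : (forall A, \sum_(i <- A) c i ^+ 2 <= M) ->
  ip (hsum (fun i => c i *: phi i)) (phi a) = c a.
Proof.
move=> cM; have cv : (fun A => ip (partial_sum (fun i => c i *: phi i) A) (phi a)) @ totally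
    --> ip (hsum (fun i => c i *: phi i)) (phi a).
  by apply: cvg_ipl => //; exact: cvg_sum_phi cM.
rewrite -(cvg_lim (@norm_hausdorff _ _) cv).
apply: cvg_lim; first exact: norm_hausdorff.
(* The coefficient at [a] is constant once the finite set contains [a]. *)
apply: cvg_near_cst; exists [fset a]%fset => // B /= aB.
by rewrite partial_sumE ip_sum_phi (fsubsetP aB) ?inE.
Qed.

Lemma phi_ext x y : (forall a, ip x (phi a) = ip y (phi a)) -> x = y.
Proof.
move=> xy; apply/eqP; rewrite -subr_eq0; apply/eqP; have [_ h] := hphi.
by apply: h => a; rewrite (ipBl hip) xy subrr.
Qed.

(** Bessel gives convergence; the sum has the coefficients of [x], and coefficients determine the
    vector. *)
Lemma cvg_Fourier x :
  partial_sum (fun i => ip x (phi i) *: phi i) @ totally --> x.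
Proof.
have xM A := Bessel x A.
suff {2}<- : hsum (fun i => ip x (phi i) *: phi i) = x by exact: (cvg_sum_phi xM).
by apply: phi_ext => a; rewrite (ip_hsum_phi _ xM).
Qed.

Lemma Parseval_le x M :
  (forall A, \sum_(i <- A) ip x (phi i) ^+ 2 <= M) -> `|x| ^+ 2 <= M.
Proof.
move=> xM; have M0 : 0 <= M by have := xM fset0; rewrite big_nil.
rewrite -(sqr_sqrtr M0) ler_pXn2r ?nnegrE ?sqrtr_ge0//.
have cv : `|partial_sum (fun i => ip x (phi i) *: phi i) A| @[A --> totally] --> `|x|.
  by apply: cvg_norm; exact: cvg_Fourier.
apply: (cvgr_to_le cv); exists fset0 => // A _ /=.
rewrite -(ler_pXn2r (ltn0Sn 1)) ?nnegrE ?sqrtr_ge0// sqr_sqrtr//.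
by rewrite partial_sumE norm_sum_phi.
Qed.

(** Turns scalar shrinkage estimates into norm estimates for the operator. *)
Lemma le_norm_coef x y :
  (forall a, `|ip x (phi a)| <= `|ip y (phi a)|) -> `|x| <= `|y|.
Proof.
move=> xy; rewrite -(ler_pXn2r (ltn0Sn 1)) ?nnegrE//.
apply: Parseval_le => A; apply: le_trans (Bessel y A).
apply: ler_sum => i _; rewrite -(real_normK (num_real (ip x _))).
by rewrite -[leRHS]real_normK ?num_real// ler_pXn2r ?nnegrE.
Qed.

End orthonormal_expansion.

(** * The thresholding operator *)

Section thresholding.
Variables (R : realType) (H : completeNormedModType R) (ip : H -> H -> R).
Hypothesis hip : inner_product ip.
Variables (Gamma : choiceType) (phi : Gamma -> H).
Hypothesis hphi : orthonormal_basis ip phi.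
Variables (w p : Gamma -> R).
Hypotheses (w_gt0 : forall i, 0 < w i) (p_ge1 : forall i, 1 <= p i).
Implicit Types x y : H.

Local Notation S := (SWP ip phi w p).

(** Since [Scp] does not increase absolute values, Bessel makes the defining series converge. *)
Lemma ip_SWP x i : ip (S x) (phi i) = Scp (w i) (p i) (ip x (phi i)).
Proof.
apply: (@ip_hsum_phi _ _ _ hip _ _ hphi (fun i => Scp (w i) (p i) (ip x (phi i)))
  (`|x| ^+ 2)) => A.
apply: le_trans (Bessel hip hphi x A); apply: ler_sum => j _.
rewrite -(real_normK (num_real (Scp _ _ _))) -[leRHS]real_normK ?num_real//.
by rewrite ler_pXn2r ?nnegrE//; exact: norm_Scp_le.
Qed.

Lemma SWP_nonexpansive x y : `|S x - S y| <= `|x - y|.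
Proof.
apply: (le_norm_coef hip hphi) => i.
by rewrite !(ipBl hip) !ip_SWP; exact: Scp_nonexpansive.
Qed.

(** With d = S x - S y and t = x - y, expanding |2d - t| <= |t| gives |d|^2 <= <d, t>, which is
    equivalent to the claim. *)
Lemma SWP_firmly_nonexpansive x y :
  `|S x - S y| ^+ 2 + `|(x - y) - (S x - S y)| ^+ 2 <= `|x - y| ^+ 2.
Proof.
have : `|(2 : R) *: (S x - S y) - (x - y)| <= `|x - y|.
  apply: (le_norm_coef hip hphi) => i.
  rewrite (ipBl hip) (ipZl hip) !(ipBl hip) !ip_SWP.
  exact: Scp_reflection_nonexpansive.
rewrite -(ler_pXn2r (ltn0Sn 1)) ?nnegrE// !(norm_sqrB hip _ (_ - _)).
rewrite (ipZl hip) normrZ exprMn (ipC hip (x - y)) ger0_norm//.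
set d := S x - S y; set t := x - y; lra.
Qed.

End thresholding.

(** * Real sequences tending to 0 *)

Section null_sequences.
Variable R : realType.
Implicit Types u r : nat -> R.

Lemma cvg0D u r : u @ \oo --> 0 -> r @ \oo --> 0 ->
  (fun k => u k + r k) @ \oo --> 0.
Proof. by move=> u0 r0; rewrite -[0]addr0; exact: cvgD. Qed.

Lemma cvg0_of_sqr_le u r : (\forall k \near \oo, u k ^+ 2 <= r k) ->
  r @ \oo --> 0 -> u @ \oo --> 0.
Proof.
move=> ur r0; apply/cvgr0Pnorm_lt => e e0.
have e2 : 0 < e ^+ 2 by rewrite exprn_gt0.
near=> k; rewrite -(ltr_pXn2r (ltn0Sn 1)) ?nnegrE ?(ltW e0)//.
rewrite real_normK ?num_real//; apply: (@le_lt_trans _ _ (r k)).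
  by near: k.
rewrite (le_lt_trans (ler_norm _))//; near: k.
exact: cvgr0_norm_lt.
Unshelve. all: by end_near. Qed.

(** [u] is nonincreasing and bounded below, hence convergent; its decrements tend to 0 and dominate
    [r]. *)
Lemma cvg0_decrement u r : (forall k, 0 <= u k) -> (forall k, 0 <= r k) ->
  (forall k, u k.+1 + r k <= u k) -> r @ \oo --> 0.
Proof.
move=> u0 r0 ur.
have cu : cvgn u.
  apply: nonincreasing_is_cvgn.
    by apply/nonincreasing_seqP => k; have := ur k; have := r0 k; lra.
  by exists 0 => _ [k _ <-].
have cd : (fun k => u k - u k.+1) @ \oo --> 0.
  rewrite -(subrr (limn u)); apply: cvgB => //.
  by rewrite cvg_shiftS.
apply: (squeeze_cvgr _ (cvg_cst 0) cd).
by near=> k; rewrite r0/=; have := ur k; lra.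
Unshelve. all: by end_near. Qed.

End null_sequences.

(** * Norm convergence from a vanishing defect *)

Section shrinkage_defect.
Variables (R : realType) (H : completeNormedModType R) (ip : H -> H -> R).
Hypothesis hip : inner_product ip.
Variables (Gamma : choiceType) (phi : Gamma -> H).
Hypothesis hphi : orthonormal_basis ip phi.
Variables (w p : Gamma -> R).
Hypotheses (w_gt0 : forall i, 0 < w i) (p_ge1 : forall i, 1 <= p i).

Local Notation S := (SWP ip phi w p).

Lemma cvg0_of_SWP_defect (c C : R) (a : H) (v : nat -> H) : 0 < c -> 0 <= C ->
  (forall i s t, `|s| <= c / 4 ->
    `|Scp (w i) (p i) (s + t) - Scp (w i) (p i) s - t| < c / 4 ->
    `|t| <= C * `|Scp (w i) (p i) (s + t) - Scp (w i) (p i) s - t|) ->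
  weak_cvg ip v 0 ->
  (fun k => `|S (a + v k) - S a - v k|) @ \oo --> 0 ->
  (fun k => `|v k|) @ \oo --> 0.
Proof.
move=> c0 C0 hC v0; set d := fun k => S (a + v k) - S a - v k => d0.
have c4 : 0 < c / 4 by rewrite divr_gt0.
have [A hA] := fset_tail_small (exprn_gt0 2 c4) (Bessel hip hphi a).
have aA i : i \notin A -> `|ip a (phi i)| <= c / 4.
  (* The tail bound (c/4)^2, tested on a singleton, bounds a single coordinate. *)
  move=> iA; have /hA : [disjoint A & [fset i]]%fset by rewrite fdisjointX1.
  by rewrite big_seq_fset1 -(real_normK (num_real (ip _ _))) ler_pXn2r ?nnegrE ?(ltW c4).
have cA (s : seq Gamma) :
    (fun k => \sum_(i <- s) ip (v k) (phi i) ^+ 2) @ \oo --> 0.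
  elim: s => [|i s IH].
    by under eq_fun do rewrite big_nil; exact: cvg_cst.
  under eq_fun do rewrite big_cons.
  apply: cvg0D; last exact: IH.
  have := v0 (phi i); rewrite (ip0l hip) => vi.
  by rewrite -(mulr0 0); under eq_fun do rewrite expr2; exact: cvgM.
(* Majorant of |v k|^2: the coordinates in [A] vanish by weak convergence, and those outside are
   controlled by the defect through [hC] and Bessel. *)
apply: (@cvg0_of_sqr_le _ _ (fun k =>
    \sum_(i <- A) ip (v k) (phi i) ^+ 2 + C ^+ 2 * (`|d k| * `|d k|))); last first.
  apply: cvg0D; first exact: cA.
  rewrite -(mulr0 (C ^+ 2)); apply: cvgM; first exact: cvg_cst.
  by rewrite -(mulr0 0); exact: cvgM.
near=> k; have dk : `|d k| < c / 4.
  have : `| `|d k| | < c / 4 by near: k; exact: cvgr0_norm_lt.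
  by rewrite normr_id.
apply: (Parseval_le hip hphi) => B.
have sqr_sum_ge0 E : 0 <= \sum_(i <- E) ip (v k) (phi i) ^+ 2.
  by apply: sumr_ge0 => i _; exact: sqr_ge0.
have BU : (B `<=` A `|` B)%fset by exact: fsubsetUr.
have AU : (A `<=` A `|` B)%fset by exact: fsubsetUl.
apply: (@le_trans _ _ (\sum_(i <- (A `|` B)%fset) ip (v k) (phi i) ^+ 2)).
  by rewrite (sum_fset_subset _ BU) lerDl.
rewrite (sum_fset_subset _ AU) lerD2l -expr2.
apply: (@le_trans _ _
    (\sum_(i <- ((A `|` B) `\` A)%fset) C ^+ 2 * ip (d k) (phi i) ^+ 2)).
  rewrite big_seq [leRHS]big_seq; apply: ler_sum => i.
  rewrite inE => /andP[iA _].
  have dE : ip (d k) (phi i) = Scp (w i) (p i) (ip a (phi i) + ip (v k) (phi i)) -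
      Scp (w i) (p i) (ip a (phi i)) - ip (v k) (phi i).
    by rewrite /d !(ipBl hip) !(ip_SWP hip hphi)// (ipDl hip).
  have di : `|ip (d k) (phi i)| < c / 4.
    rewrite (le_lt_trans _ dk)// (le_trans (Cauchy_Schwarz hip _ _))//.
    by rewrite (norm_phi hip hphi) mulr1.
  have := hC i (ip a (phi i)) (ip (v k) (phi i)) (aA i iA).
  rewrite -dE => /(_ di) ht.
  have : `|ip (v k) (phi i)| ^+ 2 <= (C * `|ip (d k) (phi i)|) ^+ 2.
    by rewrite ler_pXn2r ?nnegrE ?mulr_ge0.
  by rewrite exprMn !real_normK ?num_real.
by rewrite -mulr_sumr ler_wpM2l ?sqr_ge0//; exact: Bessel.
Unshelve. all: by end_near. Qed.

End shrinkage_defect.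

(** * Adjoints of contractions *)

Section adjoint.
Variables (R : realType) (V W : normedModType R).
Variables (ip : V -> V -> R) (ip' : W -> W -> R).
Hypotheses (hip : inner_product ip) (hip' : inner_product ip').
Variables (K : {linear V -> W}) (Kadj : W -> V).
Hypothesis hKadj : forall x y, ip' (K x) y = ip x (Kadj y).

(** [Kadj] is given only by the adjoint identity; pairing the additivity defect with itself and
    moving [K] across gives norm 0. *)
Lemma adjointB y z : Kadj (y - z) = Kadj y - Kadj z.
Proof.
apply/eqP; rewrite -subr_eq0 -normr_eq0 -sqrf_eq0 -(ip_norm hip).
set d := _ - _; rewrite /d 2!(ipBr hip) -/d -!hKadj (ipBr hip').
by rewrite subrr.
Qed.

Lemma norm_adjoint_le y : (forall x, `|K x| <= `|x|) -> `|Kadj y| <= `|y|.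
Proof.
move=> K1; have [->|y0] := eqVneq (Kadj y) 0; first by rewrite normr0.
rewrite -(ler_pM2l (x := `|Kadj y|)) ?normr_gt0// -expr2 -(ip_norm hip) -hKadj.
rewrite (le_trans (ler_norm _))// (le_trans (Cauchy_Schwarz hip' _ _))//.
by rewrite ler_wpM2r.
Qed.

End adjoint.

(** * Convergence of the iteration *)

Unset Implicit Arguments.
Set Strict Implicit.

Theorem theorem6p15 (R : realType)
  (H H' : completeNormedModType R)
  (ip : H -> H -> R) (ip' : H' -> H' -> R)
  (hip : inner_product ip) (hip' : inner_product ip')
  (Gamma : choiceType) (phi : Gamma -> H) (hphi : orthonormal_basis ip phi)
  (K : {linear H -> H'}) (Kadj : H' -> H)
  (hKadj : forall x y, ip' (K x) y = ip x (Kadj y))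
  (hKnorm : exists q : R, q < 1 /\ forall x, `|K x| <= q * `|x|)
  (g : H')
  (n : nat) (part : Gamma -> 'I_n) (pi : 'I_n -> R)
  (hpi : forall i, 1 <= pi i <= 2)
  (p : Gamma -> R) (hp : forall gm, p gm = pi (part gm))
  (w : Gamma -> R) (c : R) (hc : 0 < c) (hw : forall gm, c <= w gm)
  (f0 : H) (f : nat -> H)
  (hf0 : f 0%N = f0)
  (hf : forall k, f k.+1 = SWP ip phi w p (f k + Kadj (g - K (f k))))
  (fstar : H) (hfstar : weak_cvg ip f fstar) :
  let S := SWP ip phi w p in
  let u := fun k => f k - fstar in
  let h := fstar + Kadj (g - K fstar) in
  [/\ (fun k => `|K (u k)|) @ \oo --> 0,
      (fun k => `|S (h + u k) - S h - u k|) @ \oo --> 0,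
      (forall (a : H) (v : nat -> H), weak_cvg ip v 0 ->
         (fun k => `|S (a + v k) - S a - v k|) @ \oo --> 0 ->
         (fun k => `|v k|) @ \oo --> 0) &
      (fun k => `|u k|) @ \oo --> 0].
Proof.
move=> S u h.
have p_ge1 i : 1 <= p i by rewrite hp; have /andP[] := hpi (part i).
have w_gt0 i : 0 < w i by exact: lt_le_trans (hw i).
have K1 x : `|K x| <= `|x|.
  have [q [q1 hq]] := hKnorm; rewrite (le_trans (hq x))//.
  by rewrite -[leRHS]mul1r ler_wpM2r// ltW.
have KB := adjointB hip hip' hKadj.
have Kn y := norm_adjoint_le hip hip' hKadj y K1.
pose t k := u k - Kadj (K (u k)).
(* The data [g] cancels, so the iteration becomes a perturbation of [S] at [h]. *)
have fkE k : f k + Kadj (g - K (f k)) = h + t k.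
  rewrite /h /t /u linearB/= !KB opprB addrACA [fstar + _]addrC subrK.
  by congr (_ + _); rewrite addrA subrK.
have Sh : S h = fstar.
  (* Each coordinate of [f k.+1] has two limits to compare: the shifted weak limit, and the one
     given by continuity of [Scp]. *)
  apply: (phi_ext hip hphi) => i.
  have cS : (fun k => ip (f k.+1) (phi i)) @ \oo --> ip fstar (phi i).
    by rewrite (cvg_shiftS (fun k => ip (f k) (phi i))); exact: hfstar.
  suff cT : (fun k => ip (f k.+1) (phi i)) @ \oo --> ip (S h) (phi i).
    by rewrite -(cvg_lim (@norm_hausdorff _ _) cS) (cvg_lim (@norm_hausdorff _ _) cT).
  (* Moving the self-adjoint [Kadj] after [K] onto [phi i] lets weak convergence of [u] apply. *)
  have KK x : ip (Kadj (K x)) (phi i) = ip x (Kadj (K (phi i))).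
    by rewrite (ipC hip) -!hKadj (ipC hip').
  have ch : (fun k => ip (h + t k) (phi i)) @ \oo --> ip h (phi i).
    rewrite -[ip h _]addr0 -(subr0 0).
    under eq_fun do rewrite (ipDl hip) /t (ipBl hip) KK.
    have cu y : (fun k => ip (u k) y) @ \oo --> 0.
      rewrite -(subrr (ip fstar y)); under eq_fun do rewrite (ipBl hip).
      by apply: cvgB; [exact: hfstar|exact: cvg_cst].
    by apply: cvgD; [exact: cvg_cst|apply: cvgB].
  apply/cvgrPdist_lt => e e0; near=> k.
  rewrite hf fkE !(ip_SWP hip hphi)//.
  apply: le_lt_trans (Scp_nonexpansive _ _ _ _ _ (w_gt0 i) (p_ge1 i)) _.
  by near: k; exact: cvgr_dist_lt.
have step k : `|u k.+1| ^+ 2 + (`|K (u k)| ^+ 2 + `|t k - u k.+1| ^+ 2) <= `|u k| ^+ 2.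
  have := SWP_firmly_nonexpansive hip hphi w_gt0 p_ge1 (h + t k) h.
  have -> : h + t k - h = t k by rewrite addrAC subrr add0r.
  have -> : SWP ip phi w p (h + t k) - SWP ip phi w p h = u k.+1.
    by rewrite /u hf fkE -/S Sh.
  (* As [Kadj] is a contraction, this yields |t k|^2 <= |u k|^2 - |K (u k)|^2. *)
  have -> : `|t k| ^+ 2 = `|u k| ^+ 2 - 2 * `|K (u k)| ^+ 2 + `|Kadj (K (u k))| ^+ 2.
    by rewrite (norm_sqrB hip) -hKadj (ip_norm hip').
  have : `|Kadj (K (u k))| ^+ 2 <= `|K (u k)| ^+ 2.
    by rewrite ler_pXn2r ?nnegrE// Kn.
  lra.
have cb : (fun k => `|K (u k)| ^+ 2 + `|t k - u k.+1| ^+ 2) @ \oo --> 0.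
  by apply: (cvg0_decrement _ _ step) => k; rewrite ?addr_ge0.
have cK : (fun k => `|K (u k)|) @ \oo --> 0.
  apply: (cvg0_of_sqr_le _ cb); near=> k.
  by rewrite lerDl sqr_ge0.
have ct : (fun k => `|t k - u k.+1|) @ \oo --> 0.
  apply: (cvg0_of_sqr_le _ cb); near=> k.
  by rewrite lerDr sqr_ge0.
have cd : (fun k => `|S (h + u k) - S h - u k|) @ \oo --> 0.
  have cB : (fun k => `|K (u k)| + (`|t k - u k.+1| + `|K (u k)|)) @ \oo --> 0.
    by apply: cvg0D => //; exact: cvg0D.
  apply: (squeeze_cvgr _ (cvg_cst 0) cB); near=> k; rewrite normr_ge0/=.
  (* Insert S (h + t k) = S h + u k.+1; the first difference is then at most |u k - t k| = |Kadj (K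
     (u k))|. *)
  have -> : S (h + u k) - S h - u k =
      (S (h + u k) - S (h + t k)) - ((t k - u k.+1) + Kadj (K (u k))).
    have -> : t k - u k.+1 + Kadj (K (u k)) = u k - u k.+1.
      by rewrite addrAC subrK.
    have -> : u k.+1 = S (h + t k) - fstar by rewrite /u hf fkE.
    by rewrite Sh (opprB (u k)) !addrA subrK.
  rewrite (le_trans (ler_normB _ _))// lerD//.
    rewrite (le_trans (SWP_nonexpansive hip hphi w_gt0 p_ge1 _ _))//.
    have -> : h + u k - (h + t k) = Kadj (K (u k)).
      by rewrite opprD addrACA subrr add0r subKr.
    exact: Kn.
  by rewrite (le_trans (ler_normD _ _))// lerD2l Kn.
have [C C0 hC] : exists2 C, 0 <= C & forall i s s', `|s| <= c / 4 ->
    `|Scp (w i) (p i) (s + s') - Scp (w i) (p i) s - s'| < c / 4 ->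
    `|s'| <= C * `|Scp (w i) (p i) (s + s') - Scp (w i) (p i) s - s'|.
  have /choice[Ci hCi] : forall j, exists C, 0 <= C /\
      forall v s s', c <= v -> `|s| <= c / 4 ->
        `|Scp v (pi j) (s + s') - Scp v (pi j) s - s'| < c / 4 ->
        `|s'| <= C * `|Scp v (pi j) (s + s') - Scp v (pi j) s - s'|.
    by move=> j; have [C C0 hC] := Scp_perturbation R c (pi j) hc (hpi j); exists C.
  (* There are finitely many exponents, and the sum of nonnegative constants dominates each one. *)
  exists (\sum_j Ci j) => [|i s s' sc dc].
    by apply: sumr_ge0 => j _; have [] := hCi j.
  have [_ /(_ (w i) s s' (hw i) sc)] := hCi (part i).
  rewrite -hp => /(_ dc) /le_trans; apply; rewrite ler_wpM2r//.
  rewrite (bigD1 (part i))//= lerDl.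
  by apply: sumr_ge0 => j _; have [] := hCi j.
have hCv a v := cvg0_of_SWP_defect hip hphi w_gt0 p_ge1 (a := a) (v := v) hc C0 hC.
split=> //.
(* (D) is (C) with a = h and v = u, the defect hypothesis being (B). *)
apply: (hCv h) => // y; rewrite (ip0l hip) -(subrr (ip fstar y)).
under eq_fun do rewrite (ipBl hip).
by apply: cvgB; [exact: hfstar|exact: cvg_cst].
Unshelve. all: by end_near. Qed.
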